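(* Let $q$ be a prime power and $n,k$ positive integers. The function $g_{q-1}:\mathbb F_{q^n}\to\mathbb F_{q^n}$ is not $k$th order sum-free if and only if there exist $v_1,\dots,v_k\in\mathbb F_{q^n}$ such that $\Delta(v_1,\dots,v_k)\ne 0$ but $\Delta_1(v_1,\dots,v_k)=0$.
   Context: $g_{q-1}(x)=1/x^{q-1}$ for $x\ne 0$ and $g_{q-1}(0)=0$. A function $f:\mathbb F_{q^n}\to\mathbb F_{q^n}$ is $k$th order sum-free if $\sum_{x\in A}f(x)\ne0$ for every $k$-dimensional $\mathbb F_q$-affine subspace $A$ of $\mathbb F_{q^n}$. $\Delta(X_1,\dots,X_k)=\det\bigl(X_j^{q^i}\bigr)_{0\le i\le k-1,\,1\le j\le k}$ is the Moore determinant over $\mathbb F_q$, and $\Delta_1(X_1,\dots,X_k)$ is the $k\times k$ determinant with rows $(X_1^{q^i},\dots,X_k^{q^i})$ for $i\in\{0,2,3,\dots,k\}$ (i.e. rows $i=0,\dots,k$ with row $i=1$ omitted). *)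

(* Defs.v *)
From HB Require Import structures.
From mathcomp Require Import all_boot all_order all_algebra all_field.
Set Implicit Arguments.
Unset Strict Implicit.
Unset Printing Implicit Defensive.
Import GRing.Theory.
Local Open Scope ring_scope.

Definition g (L : fieldType) (s : nat) (x : L) : L :=
  if x == 0 then 0 else 1 / x ^+ s.

(* [finvect_type L] is [L] with the [finType] structure that it has because  *)
(* it is a finite-dimensional space over the finite field [F].               *)
Definition affine_subspace (F : finFieldType) (L : fieldExtType F) (k : nat)
    (A : {set finvect_type L}) : Prop :=
  exists (a : L) (U : {vspace L}),
    \dim U = k /\ A = [set x : finvect_type L | (x : L) - a \in U].

Definition sum_free (F : finFieldType) (L : fieldExtType F) (k : nat)
    (f : L -> L) : Prop :=
  forall A : {set finvect_type L},
    affine_subspace k A -> \sum_(x in A) f x != 0.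

Definition Delta (R : comNzRingType) (q k : nat) (v : 'rV[R]_k) : R :=
  \det (\matrix_(i < k, j < k) v 0 j ^+ (q ^ i)).

(* [bump 1] maps 0, 1, 2, ..., k - 1 to 0, 2, 3, ..., k.                      *)
Definition Delta1 (R : comNzRingType) (q k : nat) (v : 'rV[R]_k) : R :=
  \det (\matrix_(i < k, j < k) v 0 j ^+ (q ^ bump 1 i)).

(* Main.v *)
(* Let U be the span of a basis v_1, ..., v_k, and expand the Moore determinant
   P(T) = Delta(v, T) along its last column: P is a q-polynomial with leading
   coefficient Delta(v) and T^q-coefficient +-Delta1(v), and
   P(T) - P(a) = Delta(v) * prod_{x in a + U} (T - x) for every a, both sides
   having the same q^k roots.  Newton's identities for reciprocals turn the low
   coefficients of a product B = prod (T - x) with nonzero x into the power sums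
   sum x^-j.  If a is not in U, then B = (P - P(a)) / Delta(v) has only its
   coefficients B_0 and B_1 nonzero in degrees < q, and the sum of x^-(q-1) is
   (- B_1 / B_0)^(q-1) up to sign, hence nonzero.  If a is in U, then discarding
   the root 0 leaves B = P / (Delta(v) T), whose only nonzero coefficients in
   degrees < q are B_0 and B_{q-1}; the sum is B_{q-1} / B_0, which is a nonzero
   multiple of Delta1(v). *)
Require Import Defs.
From HB Require Import structures.
From mathcomp Require Import all_boot all_order all_algebra all_field.
From mathcomp Require Import ring.
Set Implicit Arguments.
Unset Strict Implicit.
Unset Printing Implicit Defensive.
Import GRing.Theory.
Local Open Scope ring_scope.

(** * Newton's identities for power sums of reciprocals *)

Section PowerSums.

Variables (K : fieldType) (s : seq K).

Let B := \prod_(x <- s) ('X - x%:P).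

Lemma XsubC_mul_geometric N (x : K) : x != 0 ->
  ('X - x%:P) * \poly_(j < N) x ^- j.+1 = x ^- N *: 'X^N - 1.
Proof.
move=> x0; elim: N => [|N IHN].
  by rewrite poly_def big_ord0 mulr0 expr0 invr1 scale1r subrr.
rewrite poly_def big_ord_recr /= -(poly_def N (fun j => x ^- j.+1)) mulrDr {}IHN -!mul_polyC !exprS.
have ->: (x ^- N)%:P = x%:P * (x * x ^+ N)^-1%:P.
  by rewrite -polyCM invfM mulrA mulfV // mul1r.
by rewrite mulrBl mulrCA; ring.
Qed.

(* [\poly_(j < N) x ^- j.+1] truncates the power series of [1 / (x - 'X)], so
   this is the logarithmic derivative [B^`() / B = \sum 1 / ('X - x)] modulo
   ['X^N]. *)
Lemma newton_reciprocal N : 0 \notin s ->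
  'X^N %| B * \sum_(x <- s) \poly_(j < N) x ^- j.+1 + B^`().
Proof.
rewrite /B; elim: s => [|x r IHr]; first by rewrite !big_nil mulr0 derivC addr0 dvdp0.
rewrite inE negb_or eq_sym => /andP[x0 /IHr{}IHr].
rewrite !big_cons derivM derivXsubC.
set C := \prod_(j <- r) _ in IHr *; set S := \sum_(j <- r) _ in IHr *.
(* The first summand is divisible by induction; in the second, the geometric sum leaves only [C]
   times [x ^- N *: 'X^N]. *)
have ->: ('X - x%:P) * C * (\poly_(j < N) x ^- j.+1 + S) + (1 * C + ('X - x%:P) * C^`())
   = ('X - x%:P) * (C * S + C^`()) + C * (('X - x%:P) * \poly_(j < N) x ^- j.+1 + 1).
  by ring.
rewrite XsubC_mul_geometric // subrK -scalerAr.
apply: dvdp_add; first exact: dvdp_mull.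
by rewrite dvdpZr ?dvdp_mull ?dvdpp // invr_eq0 expf_eq0 (negPf x0) andbF.
Qed.

(** This is the coefficient of ['X^m] in the preceding divisibility; truncation at [m.+1] does not
    affect it. *)
Lemma newton_reciprocal_coef m : 0 \notin s ->
  \sum_(i < m.+1) B`_i * (\sum_(x <- s) x ^- (m - i).+1) = - (B`_m.+1 *+ m.+1).
Proof.
move=> s0; have /dvdpP[Q /(congr1 (fun p : {poly K} => p`_m))] := newton_reciprocal m.+1 s0.
rewrite coefMXn ltnSn coefD coef_deriv coefM => /eqP; rewrite addr_eq0 => /eqP <-.
apply: eq_bigr => i _; congr (_ * _); rewrite coef_sum; apply: eq_bigr => x _.
by rewrite coef_poly ltnS leq_subr.
Qed.

Lemma prod_XsubC_coef0_neq0 : 0 \notin s -> B`_0 != 0.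
Proof. by rewrite -horner_coef0 -rootE root_prod_XsubC. Qed.

Lemma reciprocal_sum_gap m : 0 \notin s -> (forall j, (0 < j <= m)%N -> B`_j = 0) ->
  B`_0 * (\sum_(x <- s) x ^- m.+1) = - (B`_m.+1 *+ m.+1).
Proof.
move=> s0 B0; rewrite -newton_reciprocal_coef // big_ord_recl subn0 [X in _ + X]big1 ?addr0 // => i _.
by rewrite B0 ?mul0r //= ltn_ord.
Qed.

(** With [S_j] the sum of the [x ^- j], Newton's identities reduce to [B_0 S_1 = - B_1] and
    [B_0 S_(m+2) + B_1 S_(m+1) = 0], so a vanishing sum would force the previous one to vanish. *)
Lemma reciprocal_sum_neq0 N m : 0 \notin s -> B`_1 != 0 ->
    (forall j, (1 < j <= N)%N -> B`_j = 0) -> (m < N)%N ->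
  \sum_(x <- s) x ^- m.+1 != 0.
Proof.
move=> s0 B1 B0; elim: m => [|m IHm] mN; apply/eqP => S0.
  have := newton_reciprocal_coef 0 s0.
  rewrite big_ord1 /= subnn S0 mulr0 mulr1n => /esym/eqP.
  by rewrite oppr_eq0 (negPf B1).
have := newton_reciprocal_coef m.+1 s0.
rewrite 2!big_ord_recl /= subn0 S0 mulr0 add0r (B0 m.+2) // mul0rn oppr0.
rewrite subSS subn0 [X in _ + X]big1 ?addr0 => [/eqP|i _].
  by rewrite mulf_eq0 (negPf B1) (negPf (IHm (ltnW mN))).
by rewrite B0 ?mul0r // /bump /= !add1n (leq_trans _ mN) // !ltnS ltnW.
Qed.

End PowerSums.

Lemma roots_prod_XsubC (K : fieldType) (p : {poly K}) (s : seq K) :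
    (size p <= (size s).+1)%N -> all (root p) s -> uniq s ->
  p = p`_(size s) *: \prod_(x <- s) ('X - x%:P).
Proof.
move=> size_p ps us; have [p_small|] := leqP (size p) (size s).
  have -> : p = 0.
    apply/eqP; apply: contraTT p_small => p0; rewrite -ltnNge.
    by apply: max_poly_roots.
  by rewrite coef0 scale0r.
move=> p_big; have sz : size p = (size s).+1 by apply/eqP; rewrite eqn_leq size_p.
by rewrite {1}(all_roots_prod_XsubC sz ps) ?uniq_rootsE // lead_coefE sz.
Qed.

(** * Frobenius powers, q-polynomials and Moore determinants *)

Section MooreDeterminant.

Variables (F : finFieldType) (L : fieldExtType F).
Local Notation q := #|F|.

Lemma card_pchar_nat : {p : nat | p \in [pchar F] & (p.-nat q)%N}.
Proof.
have [p pr_p charF] := finPcharP F; exists p => //.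
by have := card_pprimeChar charF; rewrite /pPrimeCharType => ->; rewrite pnatX pnat_id.
Qed.

Lemma natr_card_ext : q%:R = 0 :> L.
Proof.
have [p charF qp] := card_pchar_nat; have charL : p \in [pchar L] by rewrite pchar_lalg.
apply/eqP; rewrite -(dvdn_pcharf charL).
have [m qE] := p_natP qp; case: m qE => [|m] qE; last by rewrite qE expnS dvdn_mulr.
by have := finNzRing_gt1 F; rewrite qE.
Qed.

Lemma exprD_card (x y : L) i : (x + y) ^+ (q ^ i) = x ^+ (q ^ i) + y ^+ (q ^ i).
Proof.
have [p charF qp] := card_pchar_nat; apply: exprDn_pchar.
by apply: (@sub_in_pnat p) => [r _|]; rewrite ?pnatX ?qp // inE => /eqP ->; rewrite pchar_lalg.
Qed.

Lemma exprZ_card (c : F) (x : L) i : (c *: x) ^+ (q ^ i) = c *: x ^+ (q ^ i).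
Proof.
rewrite exprZn; congr (_ *: _).
by elim: i => [|i IHi]; rewrite ?expr1 // expnSr exprM IHi expf_card.
Qed.

Definition linearized m (w : nat -> L) : {poly L} := \sum_(i < m) w i *: 'X^(q ^ i).

Lemma horner_linearized m w x : (linearized m w).[x] = \sum_(i < m) w i * x ^+ (q ^ i).
Proof.
rewrite /linearized horner_sum; apply: eq_bigr => i _.
by rewrite hornerZ hornerXn.
Qed.

Lemma size_linearized m w : (size (linearized m.+1 w) <= (q ^ m).+1)%N.
Proof.
apply: (leq_trans (size_sum _ _ _)); apply/bigmax_leqP => i _.
apply: (leq_trans (size_scale_leq _ _)); rewrite size_polyXn ltnS.
by rewrite leq_exp2l ?finNzRing_gt1 // -ltnS.
Qed.

Lemma coef_linearized_pow m w i : (i < m)%N -> (linearized m w)`_(q ^ i) = w i.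
Proof.
move=> im; rewrite /linearized coef_sum (bigD1 (Ordinal im)) //= coefZ coefXn eqxx mulr1.
rewrite big1 ?addr0 // => j; rewrite -val_eqE /= => ji.
by rewrite coefZ coefXn eqn_exp2l ?finNzRing_gt1 // eq_sym (negPf ji) mulr0.
Qed.

Lemma coef_linearized_eq0 m w j : (forall i, j != q ^ i)%N -> (linearized m w)`_j = 0.
Proof.
move=> jq; rewrite /linearized coef_sum big1 // => i _.
by rewrite coefZ coefXn (negPf (jq i)) mulr0.
Qed.

Lemma linearizedD m w x y :
  (linearized m w).[x + y] = (linearized m w).[x] + (linearized m w).[y].
Proof.
rewrite !horner_linearized -big_split; apply: eq_bigr => i _ /=.
by rewrite exprD_card mulrDr.
Qed.

Lemma linearizedZ m w (c : F) x : (linearized m w).[c *: x] = c *: (linearized m w).[x].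
Proof.
rewrite !horner_linearized scaler_sumr; apply: eq_bigr => i _ /=.
by rewrite exprZ_card scalerAr.
Qed.

Lemma linearized_span_eq0 m w (X : seq L) x :
    {in X, forall y, (linearized m w).[y] = 0} -> x \in <<X>>%VS ->
  (linearized m w).[x] = 0.
Proof.
move=> X0 /(coord_span (X := in_tuple X)) ->.
elim/big_rec: _ => [|i y _ y0].
  by have := linearizedZ m w 0 0; rewrite !scale0r.
by rewrite linearizedD linearizedZ y0 addr0 X0 ?scaler0 // mem_nth.
Qed.

Variable k : nat.
Implicit Types (v : 'rV[L]_k) (U : {vspace L}).

Definition rv_span v : {vspace L} := <<[tuple v 0%R j | j < k]>>%VS.

Definition vspace_elems U : seq L := [seq x <- enum (finvect_type L) | x \in U].

Lemma mem_vspace_elems U : vspace_elems U =i U.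
Proof.
move=> x; rewrite mem_filter; apply: andb_idr => _.
by have := mem_enum (finvect_type L) x; rewrite inE.
Qed.

Lemma uniq_vspace_elems U : uniq (vspace_elems U).
Proof. exact: filter_uniq (enum_uniq (finvect_type L)). Qed.

Lemma size_vspace_elems U : size (vspace_elems U) = (q ^ \dim U)%N.
Proof.
have /= <- := @card_vspace F (finvect_type L) _ U.
by rewrite cardE /vspace_elems enumT.
Qed.

(** A nonzero such polynomial has degree at most [q ^ (m - 1)], less than the number [q ^ \dim U] of
    its roots in [U]. *)
Lemma linearized_roots_eq0 m w U :
    (m <= \dim U)%N -> {in U, forall x, (linearized m w).[x] = 0} ->
  linearized m w = 0.
Proof.
case: m => [|m] mU wU; first by rewrite /linearized big_ord0.
apply/eqP; apply/contraTT: mU => w0; rewrite -ltnNge ltnS.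
have : (size (vspace_elems U) < size (linearized m.+1 w))%N.
  apply: max_poly_roots => //; last exact: uniq_vspace_elems.
  by apply/allP => x; rewrite mem_vspace_elems => xU; rewrite rootE wU.
move/leq_trans => /(_ _ (size_linearized _ _)).
by rewrite size_vspace_elems ltnS leq_exp2l ?finNzRing_gt1.
Qed.

(** An [F]-linear relation among the [v_j] survives the powers [q ^ i], hence relates the columns.
    Conversely, a relation among the rows is a q-polynomial with [k] coefficients that vanishes on
    the span. *)
Lemma Delta_neq0P v : reflect (\dim (rv_span v) = k) (Delta q v != 0).
Proof.
apply: (iffP idP) => [Dv | dimv].
  apply/eqP; rewrite -[X in _ == X](size_tuple [tuple v 0 j | j < k]).
  change (free [tuple v 0 j | j < k]); apply/freeP => c c0 j.
  apply: contraNeq Dv => cj0; rewrite /Delta -det_tr; apply/det0P.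
  exists (\row_i (c i)%:A).
    apply: contra_neq cj0 => /rowP/(_ j); rewrite !mxE => /eqP.
    by rewrite scaler_eq0 oner_eq0 orbF => /eqP.
  apply/rowP => i; rewrite !mxE.
  transitivity ((\sum_j c j *: v 0 j) ^+ (q ^ i)).
    rewrite (big_morph (fun x : L => x ^+ (q ^ i)) (id1 := 0) (op1 := +%R)); last 2 first.
    - by move=> x y; apply: exprD_card.
    - by rewrite expr0n expn_eq0 -leqn0 leqNgt (ltnW (finNzRing_gt1 F)).
    by apply: eq_bigr => a _; rewrite !mxE exprZ_card mulr_algl.
  suff -> : \sum_j c j *: v 0 j = 0.
    by rewrite expr0n expn_eq0 -leqn0 leqNgt (ltnW (finNzRing_gt1 F)).
  rewrite -[RHS]c0; apply: eq_bigr => a _.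
  by rewrite -tnth_nth tnth_mktuple.
apply/det0P => -[w w0 wv].
(* [W] extends [w] by 0 to all of [nat], as [linearized] requires. *)
pose W i := if insub i is Some i' then w 0 i' else 0.
have WE (i : 'I_k) : W i = w 0 i by rewrite /W valK.
have : linearized k W = 0.
  apply: (@linearized_roots_eq0 _ _ (rv_span v)); first by rewrite dimv.
  move=> x; apply: linearized_span_eq0 => _ /mapP[j _ ->].
  move/rowP/(_ j): wv; rewrite !mxE horner_linearized; apply: etrans.
  by apply: eq_bigr => i _; rewrite mxE WE.
move=> W0; case/eqP: w0; apply/rowP => i.
by rewrite mxE -WE -(coef_linearized_pow W (ltn_ord i)) W0 coef0.
Qed.

(* The cofactor of the entry [x ^ (q ^ i)] in the Moore matrix of
   [v_1, ..., v_k, x]. *)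
Definition moore_minor v (i : nat) : L :=
  (-1) ^+ (i + k) * \det (\matrix_(a < k, b < k) v 0 b ^+ (q ^ bump i a)).

(** The polynomial [P(T)], defined by its cofactor expansion so that it is a q-polynomial by
    construction. *)
Definition moore_poly v : {poly L} := linearized k.+1 (moore_minor v).

Lemma moore_polyE v x : (moore_poly v).[x] =
  \det (\matrix_(i < k.+1, j < k.+1) oapp (v 0) x (unlift ord_max j) ^+ (q ^ i)).
Proof.
rewrite (expand_det_col _ ord_max) horner_linearized; apply: eq_bigr => i _.
rewrite !mxE unlift_none /= mulrC; congr (_ * (_ * \det _)).
by apply/matrixP => a b; rewrite !mxE liftK.
Qed.

(** At [x = v_j] two columns coincide; linearity extends the vanishing to the span. *)
Lemma moore_poly_root v x : x \in rv_span v -> (moore_poly v).[x] = 0.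
Proof.
apply: linearized_span_eq0 => _ /mapP[j _ ->]; change ((moore_poly v).[v 0 j] = 0).
rewrite moore_polyE -det_tr (@determinant_alternate _ _ _ ord_max (lift ord_max j)) ?neq_lift //.
by move=> i; rewrite !mxE unlift_none liftK.
Qed.

Lemma moore_minor_last v : moore_minor v k = Delta q v.
Proof.
rewrite /moore_minor -signr_odd oddD addbb mul1r /Delta; congr (\det _).
by apply/matrixP => a b; rewrite !mxE /bump leqNgt ltn_ord.
Qed.

Lemma moore_minor1 v : moore_minor v 1 = (-1) ^+ k.+1 * Delta1 q v.
Proof. by []. Qed.

Lemma moore_poly_affineE v (a : L) (s : seq L) : \dim (rv_span v) = k ->
    uniq s -> (forall x, (x \in s) = (x - a \in rv_span v)) ->
  moore_poly v - (moore_poly v).[a]%:P = Delta q v *: \prod_(x <- s) ('X - x%:P).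
Proof.
move=> dimv us sE; set p := LHS.
have szs : size s = (q ^ k)%N.
  (* Translation by [a] maps the span bijectively onto the elements of [s]. *)
  rewrite -[in RHS]dimv -size_vspace_elems -(size_map (+%R^~ a) (vspace_elems _)).
  apply: perm_size; apply: uniq_perm => [//||x].
    by rewrite (map_inj_uniq (addIr a)); exact: uniq_vspace_elems.
  by rewrite sE -[x in RHS](subrK a) (mem_map (addIr a)) mem_vspace_elems.
have -> : Delta q v = p`_(size s).
  rewrite szs coefB coefC expn_eq0 -leqn0 leqNgt (ltnW (finNzRing_gt1 F)) subr0.
  by rewrite coef_linearized_pow // moore_minor_last.
apply: roots_prod_XsubC => //.
  rewrite szs (leq_trans (size_polyD _ _)) // geq_max size_linearized size_polyN.
  by rewrite (leq_trans (size_polyC_leq1 _)).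
apply/allP => x; rewrite sE => xv; rewrite rootE hornerD hornerN hornerC.
by rewrite -[x](subrK a) linearizedD -!/(moore_poly v) (moore_poly_root xv) add0r subrr.
Qed.

Lemma coef_moore_poly0 v : (moore_poly v)`_0 = 0.
Proof.
apply: coef_linearized_eq0 => i.
by rewrite eq_sym expn_eq0 -leqn0 leqNgt (ltnW (finNzRing_gt1 F)).
Qed.

Lemma coef_moore_poly_gap v j : (1 < j < q)%N -> (moore_poly v)`_j = 0.
Proof.
case/andP=> j1 jq; apply: coef_linearized_eq0 => -[|i]; first by rewrite neq_ltn j1 orbT.
rewrite neq_ltn (leq_trans jq) // -[X in (X <= _)%N]expn1.
by rewrite leq_exp2l ?finNzRing_gt1.
Qed.

(** * Reciprocal sums over a linear subspace without 0 *)

Section NonzeroPartOfSpan.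

Variables (v : 'rV[L]_k) (s : seq L).
Hypotheses (dimv : \dim (rv_span v) = k) (us : uniq s).
Hypothesis sE : forall x, (x \in s) = (x != 0) && (x \in rv_span v).

Let s0 : 0 \notin s. Proof. by rewrite sE eqxx. Qed.

(** Adjoining 0 to [s] gives the whole span; the extra factor ['X] shifts the index. *)
Lemma coef_moore_poly_nonzero j :
  (moore_poly v)`_j.+1 = Delta q v * (\prod_(x <- s) ('X - x%:P))`_j.
Proof.
have := @moore_poly_affineE v 0 (0 :: s) dimv.
rewrite horner_coef0 coef_moore_poly0 subr0 big_cons subr0 => ->.
- by rewrite coefZ coefXM.
- by rewrite /= s0.
by move=> x; rewrite inE sE subr0; case: eqP => // ->; rewrite mem0v.
Qed.

(** Since 0 is a simple root of [P]. The statement involves only [v], so it also serves the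
    translates of the span. *)
Lemma coef_moore_poly1_neq0 : (moore_poly v)`_1 != 0.
Proof.
rewrite coef_moore_poly_nonzero mulf_neq0 ?prod_XsubC_coef0_neq0 //.
exact/Delta_neq0P.
Qed.

Lemma reciprocal_sum_nonzero : (0 < k)%N ->
  (\sum_(x <- s) x ^- (q - 1) == 0) = (Delta1 q v == 0).
Proof.
move=> k0; have Dv : Delta q v != 0 by apply/Delta_neq0P.
have [m qE] : exists m, q = m.+2.
  by exists q.-2; have := finNzRing_gt1 F; case: q => [|[]].
have gap j : (0 < j <= m)%N -> (\prod_(x <- s) ('X - x%:P))`_j = 0.
  move=> /andP[j0 jm]; apply: (mulfI Dv); rewrite mulr0 -coef_moore_poly_nonzero.
  by apply: coef_moore_poly_gap; rewrite qE !ltnS j0.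
have := reciprocal_sum_gap s0 gap.
(* The multiplier [m.+1 = q - 1] is -1 in [L] and cancels the sign. *)
have -> : - ((\prod_(x <- s) ('X - x%:P))`_m.+1 *+ m.+1) = (\prod_(x <- s) ('X - x%:P))`_m.+1.
  apply/eqP; rewrite eq_sym -addr_eq0 -mulrS -qE -mulr_natr natr_card_ext mulr0 //.
(* Multiplying by the nonzero [B_0] and then [Delta q v] turns the sum into the coefficient of
   ['X^q] in [P], which is [Delta1 q v] up to sign; [0 < k] puts index 1 in range. *)
rewrite qE subSS subn0 => SE; rewrite -[LHS](mulrI_eq0 _ (lregP (prod_XsubC_coef0_neq0 s0))).
rewrite SE -[LHS](mulrI_eq0 _ (lregP Dv)) -coef_moore_poly_nonzero -qE -[in LHS](expn1 q).
by rewrite coef_linearized_pow // moore_minor1 mulf_eq0 signr_eq0.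
Qed.

End NonzeroPartOfSpan.

Lemma reciprocal_sum_affine_neq0 v (a : L) (s : seq L) : \dim (rv_span v) = k ->
    uniq s -> (forall x, (x \in s) = (x - a \in rv_span v)) -> 0 \notin s ->
  \sum_(x <- s) x ^- (q - 1) != 0.
Proof.
move=> dimv us sE s0; have Dv : Delta q v != 0 by apply/Delta_neq0P.
have PE j : (0 < j)%N -> (moore_poly v)`_j = Delta q v * (\prod_(x <- s) ('X - x%:P))`_j.
  move=> j0; rewrite -coefZ -(moore_poly_affineE dimv us sE) coefB coefC.
  by rewrite -[j == 0]negbK -lt0n j0 subr0.
have [m qE] : exists m, q = m.+2.
  by exists q.-2; have := finNzRing_gt1 F; case: q => [|[]].
rewrite qE subSS subn0; apply: (reciprocal_sum_neq0 (N := m.+1)) => // [|j /andP[j1 jm]].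
  suff : (moore_poly v)`_1 != 0 by rewrite PE // mulf_eq0 (negPf Dv).
  apply: (@coef_moore_poly1_neq0 v [seq x <- vspace_elems (rv_span v) | x != 0]) => //.
    exact: filter_uniq (uniq_vspace_elems _).
  by move=> x; rewrite mem_filter mem_vspace_elems.
apply: (mulfI Dv); rewrite mulr0 -PE ?(ltnW j1) //.
by apply: coef_moore_poly_gap; rewrite qE j1.
Qed.

Lemma rv_span_vbasis U : \dim U = k -> exists v, rv_span v = U.
Proof.
move=> dimU; exists (\row_j (vbasis U)`_j); rewrite /rv_span -[RHS](span_basis (vbasisP U)).
congr (span _); apply: (@eq_from_nth _ 0); first by rewrite !size_tuple.
move=> i; rewrite size_tuple => ik; rewrite -(tnth_nth _ _ (Ordinal ik)).
by rewrite tnth_mktuple mxE.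
Qed.

End MooreDeterminant.

(** * Sums of [g] as reciprocal sums over nonzero elements *)

Lemma sum_g_seq (K : fieldType) (r : seq K) m :
  \sum_(x <- r) g m x = \sum_(x <- [seq x <- r | x != 0]) x ^- m.
Proof.
rewrite big_filter [RHS]big_mkcond; apply: eq_bigr => x _.
by rewrite /g; case: eqP => //= _; rewrite div1r.
Qed.

Section NonzeroElements.

Variables (F : finFieldType) (L : fieldExtType F) (A : {set finvect_type L}).

Definition nonzero_elems : seq L := [seq x <- enum A | (x : L) != 0].

Lemma mem_nonzero_elems (x : L) :
  (x \in nonzero_elems) = (x != 0) && ((x : finvect_type L) \in A).
Proof. by rewrite mem_filter; congr (_ && _); apply: (mem_enum A). Qed.

Lemma uniq_nonzero_elems : uniq nonzero_elems.
Proof. exact: filter_uniq (enum_uniq A). Qed.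

Lemma sum_g_set m : \sum_(x in A) @g L m x = \sum_(x <- nonzero_elems) x ^- m.
Proof. by rewrite -big_enum; apply: (@sum_g_seq L). Qed.

End NonzeroElements.

Theorem theorem4p6 (q n k : nat)
    (hq : exists p e : nat, [/\ prime p, (0 < e)%N & q = (p ^ e)%N])
    (hn : (0 < n)%N) (hk : (0 < k)%N)
    (F : finFieldType) (L : fieldExtType F)
    (hF : #|F| = q) (hL : \dim {:L} = n) :
  ~ sum_free k (@g L (q - 1)) <->
  exists v : 'rV[L]_k, Delta q v <> 0 /\ Delta1 q v = 0.
Proof.
subst q; split; last first.
  case=> v [/eqP/Delta_neq0P dimv /eqP D1v] sumf.
  pose A := [set x : finvect_type L | (x : L) - 0 \in rv_span v].
  have /negP[] : \sum_(x in A) @g L (#|F| - 1) x != 0.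
    by apply: sumf; exists 0, (rv_span v).
  rewrite sum_g_set (reciprocal_sum_nonzero dimv) //.
    exact: uniq_nonzero_elems.
  by move=> x; rewrite mem_nonzero_elems inE subr0.
(* Finiteness of [L] makes the existence of [v] decidable; if there is none, sum-freeness is
   proved. *)
have [/existsP[v /andP[/eqP Dv /eqP D1v]] _|noV []] := boolP
  [exists v : 'rV[finvect_type L]_k,
     (Delta #|F| (v : 'rV[L]_k) != 0) && (Delta1 #|F| (v : 'rV[L]_k) == 0)].
  by exists v.
move=> A [a [U [dimU ->]]]; have [v vU] := rv_span_vbasis dimU.
have dimv : \dim (rv_span v) = k by rewrite vU.
rewrite sum_g_set -vU; set s := nonzero_elems _.
have us : uniq s by exact: uniq_nonzero_elems.
have sE (x : L) : (x \in s) = (x != 0) && (x - a \in rv_span v).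
  by rewrite mem_nonzero_elems inE.
(* Either the coset of [a] is the span itself, or it misses 0 and [s] lists all of it. *)
have [av|av] := boolP (a \in rv_span v).
  rewrite (reciprocal_sum_nonzero dimv us) // => [|x]; last by rewrite sE (rpredBr _ av).
  apply: contra noV => D1v; apply/existsP; exists v; rewrite D1v andbT.
  exact/Delta_neq0P.
apply: (reciprocal_sum_affine_neq0 dimv us (a := a)) => [x|]; last by rewrite sE eqxx.
by rewrite sE; case: eqP => // ->; rewrite sub0r memvN (negPf av).
Qed.
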